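(* If $\mathcal{A}$ is a minimal linear strand (MLS) central arrangement of hyperplanes in $\mathbb{C}^\ell$, then all components of the resonance variety $\mathcal{R}^1(\mathcal{A})$ are local; that is, every nonzero $a\in\mathcal{R}^1(\mathcal{A})$ belongs to the local component $L_X$ for some $X\in L_2(\mathcal{A})$ with $\mu(X)\ge2$.
   Context: $\Bbbk$ is a field of characteristic $0$. For a finite central arrangement $\mathcal{A}=\{H_1,\dots,H_n\}$ of hyperplanes in $\mathbb{C}^\ell$, let $E$ be the exterior algebra over $\Bbbk$ on degree-one generators $e_1,\dots,e_n$, with derivation $\partial$ given by $\partial(e_i)=1$ and the graded Leibniz rule, and $e_J=e_{i_1}\wedge\cdots\wedge e_{i_r}$ for $J=\{i_1<\dots<i_r\}$. The Orlik-Solomon ideal $I\subset E$ is generated by all $\partial e_J$ with $\operatorname{codim}\bigcap_{i\in J}H_i<|J|$; the Orlik-Solomon algebra is $A=E/I$, graded by degree, with $A_1=E_1$. The graded Betti numbers are $b'_{ij}=\dim_\Bbbk\operatorname{Tor}_i^E(A,\Bbbk)_j$ ($j$ is the internal degree). $L_2(\mathcal{A})$ is the set of rank (codimension) $2$ elements of the intersection lattice of $\mathcal{A}$ and $\mu$ is the Möbius function of that lattice; for $X\in L_2(\mathcal{A})$, $\mu(X)=|\{H\in\mathcal{A}: H\supset X\}|-1$. $\mathcal{A}$ is called minimal linear strand (MLS) if $b'_{23}=2\sum_{X\in L_2(\mathcal{A})}\binom{\mu(X)+1}{3}$. The first resonance variety is $\mathcal{R}^1(\mathcal{A})=\{a\in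 E_1\mid H^1(A,\cdot a)\neq0\}$, where $(A,\cdot a)$ is the cochain complex $A_0\to A_1\to A_2\to\cdots$ with differential multiplication by $a$. The local component associated to $X\in L_2(\mathcal{A})$ with $\mu(X)\ge2$ is the linear subspace $L_X=\{\sum_{H_i\supset X}\lambda_ie_i\mid \sum\lambda_i=0\}$ of $E_1$, of dimension $\mu(X)$. *)

(* Defs.v *)
From HB Require Import structures.
From mathcomp Require Import all_boot all_order all_algebra all_field.

Set Implicit Arguments.
Unset Strict Implicit.
Unset Printing Implicit Defensive.

Import Order.TTheory GRing.Theory Num.Theory.

Local Open Scope ring_scope.

(* An element is the family of its coordinates in the basis [e_J]. *)
Definition ext (k : fieldType) (n : nat) : Type := {ffun {set 'I_n} -> k^o}.

HB.instance Definition _ (k : fieldType) (n : nat) :=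
  Vector.copy (ext k n) {ffun {set 'I_n} -> k^o}.

(* The number of transpositions needed to sort the concatenation of the
   increasing enumerations of [J] and [K]. *)
Definition crossings (n : nat) (J K : {set 'I_n}) : nat :=
  (\sum_(i in J) \sum_(j in K) (j < i))%N.

Section ExteriorRing.
Variables (k : fieldType) (n : nat).
Implicit Types (x y z : ext k n) (J K L M : {set 'I_n}).

Definition ebasis J : ext k n := [ffun K => (K == J)%:R].

Definition ewedge x y : ext k n :=
  [ffun L : {set 'I_n} => \sum_(J : {set 'I_n} | J \subset L)
     (-1) ^+ crossings J (L :\: J) * (x J * y (L :\: J))].

Lemma crossingsUl J K L : [disjoint J & K] ->
  crossings (J :|: K) L = (crossings J L + crossings K L)%N.
Proof. by move=> dJK; rewrite /crossings -bigU //=; apply: eq_bigl => i; rewrite inE. Qed.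

Lemma crossingsUr J K L : [disjoint J & K] ->
  crossings L (J :|: K) = (crossings L J + crossings L K)%N.
Proof.
move=> dJK; rewrite /crossings -big_split /=; apply: eq_bigr => i _.
by rewrite -bigU //=; apply: eq_bigl => j; rewrite inE.
Qed.

Lemma crossings0l L : crossings set0 L = 0%N.
Proof. by rewrite /crossings big_set0. Qed.

Lemma crossings0r L : crossings L set0 = 0%N.
Proof. by rewrite /crossings big1 // => i _; rewrite big_set0. Qed.

Fact ewedgeA : associative ewedge.
Proof.
move=> x y z; apply/ffunP => L; rewrite !ffunE.
transitivity (\sum_(J : {set 'I_n} | J \subset L)
   \sum_(K : {set 'I_n} | (K \subset L) && (J \subset K))
   (-1) ^+ (crossings K (L :\: K) + crossings J (K :\: J)) *
     (x J * y (K :\: J) * z (L :\: K))); last first.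
  rewrite (exchange_big_dep (fun K => K \subset L)) /=; last by move=> J K _; case/andP.
  apply: eq_bigr => K sKL; rewrite !ffunE mulr_suml mulr_sumr.
  have e J : (J \subset L) && ((K \subset L) && (J \subset K)) = (J \subset K).
    rewrite sKL /=; case sJK: (J \subset K); rewrite ?andbF ?andbT //.
    exact: subset_trans sKL.
  by rewrite (eq_bigl _ _ e); apply: eq_bigr => J _; rewrite exprD !mulrA.
apply: eq_bigr => J sJL; rewrite !ffunE !mulr_sumr.
rewrite [RHS](reindex_onto (fun M => J :|: M) (fun K => K :\: J)) /=; last first.
  by move=> K /andP[_ sJK]; rewrite setDE setUIr setUCr setIT; apply/setUidPr.
have e M : (J :|: M \subset L) && (J \subset J :|: M) && ((J :|: M) :\: J == M)
    = (M \subset L :\: J).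
  rewrite subUset sJL subsetUl /= andbT subsetD; congr (_ && _).
  by rewrite setDUl setDv set0U; apply/eqP/setDidPl.
rewrite (eq_bigl _ _ e); apply: eq_bigr => M.
rewrite subsetD => /andP[sML dMJ].
have -> : (J :|: M) :\: J = M by rewrite setDUl setDv set0U; apply/setDidPl.
rewrite -setDDl; set N := L :\: J :\: M.
have dJM : [disjoint J & M] by rewrite disjoint_sym.
have -> : L :\: J = M :|: N.
  rewrite /N; apply/setP => i; rewrite !inE.
  case iM: (i \in M) => //=; rewrite (subsetP sML) // andbT.
  by rewrite (disjointFr dMJ).
have dMN : [disjoint M & N].
  by rewrite disjoint_sym disjoints_subset /N setDE subsetIr.
rewrite (crossingsUl _ dJM) (crossingsUr _ dMN) !exprD.
move: ((-1) ^+ _) ((-1) ^+ _) ((-1) ^+ _) (x J) (y M) (z N) => a b c u v w.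
rewrite [u * (a * _)]mulrCA !mulrA; congr (_ * _ * _ * _).
by rewrite [c * b]mulrC mulrAC.
Qed.

Fact ewedge1l : left_id (ebasis set0) ewedge.
Proof.
move=> x; apply/ffunP => L; rewrite !ffunE.
rewrite (bigD1 set0) ?sub0set //= ffunE eqxx setD0 crossings0l mul1r mul1r.
by rewrite big1 ?addr0 // => J /andP[_ /negPf n0]; rewrite ffunE n0 mul0r mulr0.
Qed.

Fact ewedge1r : right_id (ebasis set0) ewedge.
Proof.
move=> x; apply/ffunP => L; rewrite !ffunE.
rewrite (bigD1 L) //= ffunE setDv eqxx crossings0r mul1r mulr1.
rewrite big1 ?addr0 // => J /andP[sJL nJL]; rewrite ffunE.
case: eqP => [/eqP|_]; last by rewrite !mulr0.
rewrite setD_eq0 => sLJ; case/eqP: nJL; apply/eqP.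
by rewrite eqEsubset sJL.
Qed.

Fact ewedgeDl : left_distributive ewedge +%R.
Proof.
move=> x y z; apply/ffunP => L; rewrite !ffunE -big_split /=.
by apply: eq_bigr => J _; rewrite ffunE mulrDl mulrDr.
Qed.

Fact ewedgeDr : right_distributive ewedge +%R.
Proof.
move=> x y z; apply/ffunP => L; rewrite !ffunE -big_split /=.
by apply: eq_bigr => J _; rewrite ffunE mulrDr mulrDr.
Qed.

Fact ebasis0_neq0 : ebasis set0 != 0.
Proof.
by apply/eqP => /ffunP/(_ set0)/eqP; rewrite !ffunE eqxx oner_eq0.
Qed.

HB.instance Definition _ := GRing.Zmodule_isNzRing.Build (ext k n)
  ewedgeA ewedge1l ewedge1r ewedgeDl ewedgeDr ebasis0_neq0.

Fact ewedgeZl (c : k) x y : c *: (x * y) = (c *: x) * y.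
Proof.
apply/ffunP => L; rewrite !ffunE scaler_sumr.
by apply: eq_bigr => J _; rewrite !ffunE /GRing.scale /= mulrCA !mulrA.
Qed.

HB.instance Definition _ :=
  GRing.Lmodule_isLalgebra.Build k (ext k n) ewedgeZl.

Fact ewedgeZr (c : k) x y : c *: (x * y) = x * (c *: y).
Proof.
apply/ffunP => L; rewrite !ffunE scaler_sumr.
apply: eq_bigr => J _; rewrite !ffunE /GRing.scale /= mulrCA.
by congr (_ * _); rewrite mulrCA.
Qed.

HB.instance Definition _ :=
  GRing.Lalgebra_isAlgebra.Build k (ext k n) ewedgeZr.

HB.instance Definition _ := Algebra_isFalgebra.Build k (ext k n).

End ExteriorRing.

Section ExteriorTheory.
Variables (k : fieldType) (n : nat).
Implicit Types (x y z : ext k n) (J K L M : {set 'I_n}) (i j : 'I_n).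

Lemma ebasisE J K : ebasis k J K = (K == J)%:R.
Proof. by rewrite ffunE. Qed.

Lemma ext0E J : (0 : ext k n) J = 0.
Proof. exact: ffunE. Qed.

Lemma extDE x y J : (x + y) J = x J + y J.
Proof. exact: ffunE. Qed.

Lemma extNE x J : (- x) J = - x J.
Proof. exact: ffunE. Qed.

Lemma extZE (c : k) x J : (c *: x) J = c * x J.
Proof. exact: ffunE. Qed.

Definition extE := (ebasisE, ext0E, extDE, extNE, extZE).

Lemma ext_sumE (I : Type) (r : seq I) (P : pred I) (F : I -> ext k n) J :
  (\sum_(i <- r | P i) F i) J = \sum_(i <- r | P i) F i J.
Proof.
by elim/big_rec2: _ => [|i u v _ <-]; rewrite extE.
Qed.

Definition egen i : ext k n := ebasis k [set i].

Lemma ext_sum_basis x : x = \sum_J x J *: ebasis k J.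
Proof.
apply/ffunP => L; rewrite ext_sumE (bigD1 L) //= big1 => [|J nJL].
  by rewrite !extE eqxx addr0 mulr1.
by rewrite !extE eq_sym (negPf nJL) mulr0.
Qed.

Lemma ebasis_mulE J y L : (ebasis k J * y : ext k n) L =
  if J \subset L then (-1) ^+ crossings J (L :\: J) * y (L :\: J) else 0.
Proof.
rewrite ffunE; case: ifPn => sJL.
  rewrite (bigD1 J) //= ebasisE eqxx mul1r big1 ?addr0 // => K /andP[_ nKJ].
  by rewrite ebasisE (negPf nKJ) mul0r mulr0.
rewrite big1 // => K sKL; rewrite ebasisE.
by case: eqP => [eKJ|_]; [rewrite -eKJ sKL in sJL | rewrite mul0r mulr0].
Qed.

Lemma ebasisM J K : ebasis k J * ebasis k K =
  if [disjoint J & K] then (-1) ^+ crossings J K *: ebasis k (J :|: K) else 0.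
Proof.
apply/ffunP => L; rewrite ebasis_mulE; case dJK: [disjoint J & K]; rewrite !extE.
  case: ifPn => sJL; last first.
    case: eqP => [eL|_]; last by rewrite mulr0.
    by rewrite eL subsetUl in sJL.
  have -> : (L == J :|: K) = (L :\: J == K).
    apply/eqP/eqP => [->|<-].
      by rewrite setDUl setDv set0U; apply/setDidPl; rewrite disjoint_sym.
    by rewrite setDE setUIr setUCr setIT; apply/esym/setUidPr.
  by case: eqP => [->|_] //; rewrite ?mulr0 ?mulr0.
case: ifP => // sJL; case: eqP => [eK|_]; last by rewrite mulr0.
by rewrite -eK disjoint_sym disjoints_subset setDE subsetIr in dJK.
Qed.

Lemma ebasis_prod J : ebasis k J = \prod_(i in J) egen i.
Proof.
have ltT : transitive (fun i j : 'I_n => (i < j)%N) by move=> j i m; apply: ltn_trans.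
rewrite -big_filter.
have -> : [seq i <- index_enum 'I_n | i \in J] = enum J.
  by rewrite [index_enum _]unlock.
have: sorted (fun i j : 'I_n => (i < j)%N) (enum J).
  rewrite {1}/enum_mem -enumT; apply: sorted_filter => //.
  have := iota_ltn_sorted 0 n; rewrite -val_enum_ord sorted_map.
  by apply: sub_sorted.
have {2}-> : J = [set i in enum J] by apply/setP => i; rewrite inE mem_enum.
elim: (enum J) => [_|i s IHs] /=.
  rewrite big_nil -[RHS]/(ebasis k set0).
  by congr (ebasis k _).
rewrite (path_sortedE ltT) => /andP[/allP lis ss].
have nis : i \notin s by apply/negP => /lis; rewrite ltnn.
rewrite big_cons -IHs // /egen ebasisM disjoints1 inE nis.
have -> : crossings [set i] [set j in s] = 0%N.
  rewrite /crossings big1 // => j /set1P ->; rewrite big1 // => m.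
  by rewrite inE => /lis im; rewrite ltnNge (ltnW im).
by rewrite scale1r; congr (ebasis k _); apply/setP => j; rewrite !inE.
Qed.

(* The coefficient of [e_K] in [d x], where
   [d e_J = \sum_(i in J) (-1)^#{j in J | j < i} e_(J \ i)]. *)
Definition eder x : ext k n :=
  [ffun K : {set 'I_n} => \sum_(i | i \notin K)
     (-1) ^+ crossings [set i] K * x (i |: K)].

Fact eder_is_linear : linear eder.
Proof.
move=> c x y; apply/ffunP => K; rewrite !(extE, ffunE) mulr_sumr -big_split /=.
by apply: eq_bigr => i _; rewrite !extE mulrDr mulrCA.
Qed.

HB.instance Definition _ :=
  GRing.isLinear.Build k (ext k n) (ext k n) _ eder eder_is_linear.

Lemma eder_basis J : eder (ebasis k J) =
  \sum_(i in J) (-1) ^+ crossings [set i] J *: ebasis k (J :\ i).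
Proof.
apply/ffunP => K; rewrite ffunE ext_sumE.
rewrite [LHS]big_mkcond [RHS]big_mkcond; apply: eq_bigr => i _.
rewrite !extE.
case: ifPn => iK; case: ifPn => iJ.
- have -> : (i |: K == J) = (K == J :\ i).
    by apply/eqP/eqP => [<-|->]; rewrite ?setD1K // setU1K.
  case: eqP => [->|_]; last by rewrite mulr0 mulr0.
  rewrite -[in RHS](setD1K iJ) crossingsUr ?disjoints1 ?inE ?eqxx //.
  by rewrite {2}/crossings !big_set1 ltnn add0n.
- case: eqP => [eJ|_]; last by rewrite mulr0.
  by rewrite -eJ setU11 in iJ.
- case: eqP => [eK|_]; last by rewrite mulr0.
  by rewrite eK !inE eqxx in iK.
- by [].
Qed.

Lemma eder1 : eder 1 = 0.
Proof. by rewrite (eder_basis set0) big_set0. Qed.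

Lemma eder_gen i : eder (egen i) = 1.
Proof.
rewrite eder_basis big_set1 /crossings !big_set1 ltnn scale1r.
by rewrite setDv.
Qed.

Lemma eder_genM i y : eder (egen i * y) = y - egen i * eder y.
Proof.
apply/ffunP => K; rewrite extDE extNE ebasis_mulE sub1set [LHS]ffunE.
under eq_bigr do rewrite ebasis_mulE sub1set !inE.
have [iK|iK] := boolP (i \in K); last first.
  rewrite subr0 (bigD1 i) //= eqxx /= setU1K // big1 ?addr0.
    by rewrite mulrA -expr2 sqrr_sign mul1r.
  by move=> m /andP[mK nmi]; rewrite eq_sym (negPf nmi) mulr0.
rewrite [eder y _]ffunE [in RHS](bigD1 i) ?inE ?eqxx //= setD1K // mulrDr.
rewrite mulrA -expr2 sqrr_sign mul1r opprD addNKr mulr_sumr -sumrN.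
apply: eq_big => [m|m mK].
  by rewrite !inE; case: eqP => [->|] /=; rewrite ?iK ?andbT.
have nmi : m != i by apply: contraNneq mK => ->.
have eS : (m |: K) :\ i = m |: (K :\ i).
  by apply/setP => j; rewrite !inE; case: (j =P m) => [->|]; rewrite ?nmi.
rewrite orbT eS.
have dmK : [disjoint [set m] & K :\ i] by rewrite disjoints1 !inE (negPf mK) andbF.
have diK : [disjoint [set i] & K :\ i] by rewrite disjoints1 !inE eqxx.
rewrite (crossingsUr _ dmK) -{1}(setD1K iK) (crossingsUr _ diK) !exprD.
rewrite /crossings !big_set1; move: nmi; rewrite -val_eqE /= => nmi.
set a := (-1) ^+ _; set b := (-1) ^+ _; set c := (-1) ^+ _; set d := (-1) ^+ _.
have -> : c = - a.
  by rewrite /c /a; case: ltngtP nmi => //= _ _; rewrite ?expr1 ?expr0 ?opprK.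
have aa : a * a = 1 by rewrite -expr2 sqrr_sign.
by rewrite mulNr mulNr mulrN mulrA mulrACA aa mul1r mulrA [b * d]mulrC.
Qed.

Lemma eder_basisM J y : eder (ebasis k J * y) =
  eder (ebasis k J) * y + (-1) ^+ #|J| *: (ebasis k J * eder y).
Proof.
have [m] := ubnP #|J|; elim: m J => // m IHm J leJm.
have [->|[i iJ]] := set_0Vmem J.
  by rewrite cards0 expr0 scale1r !mul1r eder1 mul0r add0r.
have eJ : ebasis k J =
    (-1) ^+ crossings [set i] (J :\ i) *: (egen i * ebasis k (J :\ i)).
  rewrite ebasisM disjoints1 !inE eqxx /= scalerA -exprD addnn -mul2n.
  by rewrite exprM sqrrN !expr1n scale1r setD1K.
rewrite (cardsD1 i) iJ in leJm *.
set u := ebasis k (J :\ i) in eJ *; set c := (-1) ^+ _ in eJ.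
rewrite eJ -!scalerAl linearZ /= [eder (c *: _)]linearZ /= -!scalerAl.
rewrite [X in _ = _ + X]scalerA [X in _ = _ + X *: _]mulrC -scalerA -scalerDr.
congr (_ *: _); rewrite -mulrA !eder_genM IHm // mulrDr mulrBl opprD addrA.
by rewrite -scalerAr !mulrA exprD expr1 mulN1r scaleNr.
Qed.

(* Zero for negative [p]. *)
Definition extdeg (p : int) : {vspace ext k n} :=
  <<[seq ebasis k J | J <- enum {set 'I_n} & #|J|%:Z == p]>>%VS.

Lemma mem_extdeg (p : int) x :
  reflect (forall J, x J != 0 -> #|J|%:Z = p) (x \in extdeg p).
Proof.
apply: (iffP idP) => [xp J|xp].
  apply: contra_neq_eq => np; rewrite (@coord_span _ _ _ (in_tuple _) _ xp) ext_sumE big1 // => i _.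
  have /mapP[K] := mem_nth 0 (ltn_ord i).
  rewrite mem_filter => /andP[/eqP Kp _] ->; rewrite !extE.
  by case: (J =P K) np => [->|_ _]; [rewrite Kp eqxx | rewrite mulr0].
rewrite (ext_sum_basis x); apply: memv_suml => J _.
have [->|xJ] := eqVneq (x J) 0; first by rewrite scale0r mem0v.
apply: memvZ; apply: memv_span; apply: map_f.
by rewrite mem_filter xp // eqxx mem_enum.
Qed.

End ExteriorTheory.

Section Betti.
Variables (k : fieldType) (n : nat).

(* The ring morphism [E -> k] killing all the [e_i]. *)
Definition ecounit (x : ext k n) : k := x set0.

(* A resolution of the graded left module [E / I] by finitely generated graded
   free modules [F_i = \bigoplus_s E(- gdeg i s)].  Elements of [F_i] are row
   vectors and maps act by right multiplication by matrices; the map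
   [F_0 -> E / I] is given by representatives in [E] of the images of the
   generators. *)
Record graded_free_resolution (I : {vspace ext k n}) := GradedFreeResolution {
  rk : nat -> nat;
  gdeg : forall i, 'I_(rk i) -> int;
  diff : forall i, 'M[ext k n]_(rk i.+1, rk i);
  aug : 'cV[ext k n]_(rk 0);
  diff_homog : forall i s t, diff i s t \in extdeg k n (gdeg s - gdeg t);
  aug_homog : forall s, aug s ord0 \in extdeg k n (gdeg s);
  aug_onto : forall x : ext k n,
    exists v : 'rV_(rk 0), (v *m aug) ord0 ord0 - x \in I;
  aug_exact : forall v : 'rV_(rk 0),
    (v *m aug) ord0 ord0 \in I <-> exists w : 'rV_(rk 1), v = w *m diff 0;
  diff_exact : forall i (v : 'rV_(rk i.+1)),
    v *m diff i = 0 <-> exists w : 'rV_(rk i.+2), v = w *m diff i.+1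
}.

Variables (I : {vspace ext k n}) (F : graded_free_resolution I).

(* The differentials of [k \otimes_E F], entering and leaving degree [i]. *)
Definition kdiff_in (i : nat) : 'M[k]_(rk F i.+1, rk F i) :=
  map_mx ecounit (diff F i).

Definition kdiff_out (i : nat) : 'M[k]_(rk F i, rk F i.-1) :=
  match i with 0 => 0 | i'.+1 => kdiff_in i' end.

(* The row space of this matrix is the part of internal degree [j] of
   [k \otimes_E F_i]. *)
Definition kstrand (i : nat) (j : int) : 'M[k]_(rk F i) :=
  diag_mx (\row_s (gdeg s == j)%:R).

(* [\dim_k Tor_i(E / I, k)_j], the homology of [k \otimes_E F]. *)
Definition tor_dim (i : nat) (j : int) : nat :=
  (\rank (kstrand i j :&: kermx (kdiff_out i))%MS
   - \rank (kstrand i.+1 j *m kdiff_in i))%N.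

End Betti.

(* Tor does not depend on the resolution used to compute it. *)
Definition is_betti (k : fieldType) (n : nat) (I : {vspace ext k n})
    (i : nat) (j : int) (b : nat) : Prop :=
  exists F : graded_free_resolution I, tor_dim F i j = b.

Record arrangement (C : fieldType) (l n : nat) := Arrangement {
  hyp :> 'I_n -> {vspace 'rV[C]_l};
  hyp_inj : injective hyp;
  hyp_dim : forall i, (\dim (hyp i)).+1 = l
}.

Section Arrangement.
Variables (C : fieldType) (l n : nat) (A : arrangement C l n).
Implicit Types (X Y : {vspace 'rV[C]_l}) (J : {set 'I_n}).

Definition codim X : nat := (l - \dim X)%N.

Definition lattice : seq {vspace 'rV[C]_l} :=
  undup [seq (\bigcap_(i in J) A i)%VS | J : {set 'I_n}].

Definition rank2 : seq {vspace 'rV[C]_l} := [seq X <- lattice | codim X == 2].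

(* The lattice is ordered by reverse inclusion, with least element the whole
   space; the fuel [d] is enough as soon as it exceeds the codimension. *)
Fixpoint mobius_rec (d : nat) X : int :=
  if d isn't d'.+1 then 0 else
  if X == fullv then 1 else
  - \sum_(Y <- lattice | (X <= Y)%VS && (Y != X)) mobius_rec d' Y.

Definition mobius X : int := mobius_rec (codim X).+1 X.

Lemma dim_row_space : \dim {: 'rV[C]_l} = l.
Proof. by rewrite dimvf /dim /= mul1n. Qed.

Lemma codim_fullv : codim fullv = 0%N.
Proof. by rewrite /codim dim_row_space subnn. Qed.

Lemma codim_eq0 X : (codim X == 0%N) = (X == fullv).
Proof.
apply/idP/eqP => [|->]; last by rewrite codim_fullv.
rewrite subn_eq0 => lX; apply/eqP; rewrite eqEdim subvf /=.
by rewrite dim_row_space.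
Qed.

Lemma codim_ltn X Y : (X <= Y)%VS -> Y != X -> (codim Y < codim X)%N.
Proof.
move=> sXY nYX; have := dimvS (subvf Y); rewrite dim_row_space => Yl.
have ltXY : (\dim X < \dim Y)%N.
  by rewrite ltnNge; apply: contra nYX => le; rewrite eq_sym eqEdim sXY.
by apply: ltn_sub2l => //; apply: leq_trans ltXY Yl.
Qed.

Lemma mobius_rec_fuel d X : (codim X < d)%N -> mobius_rec d X = mobius X.
Proof.
rewrite /mobius; have [m] := ubnP (codim X).
elim: m d X => // m IHm [//|d] X; rewrite ltnS => leXm; rewrite ltnS => leXd /=.
case: eqP => // _; congr (- _); apply: eq_bigr => Y /andP[sXY nYX].
have ltYX := codim_ltn sXY nYX.
rewrite !IHm //; exact: leq_trans ltYX _.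
Qed.

Lemma mobius_fullv : mobius fullv = 1.
Proof. by rewrite /mobius /= eqxx. Qed.

Lemma mobius_neq X : X != fullv ->
  mobius X = - \sum_(Y <- lattice | (X <= Y)%VS && (Y != X)) mobius Y.
Proof.
move=> nX; rewrite {1}/mobius /= (negPf nX); congr (- _).
by apply: eq_bigr => Y /andP[sXY nYX]; rewrite mobius_rec_fuel // codim_ltn.
Qed.

Lemma mem_lattice J : (\bigcap_(i in J) A i)%VS \in lattice.
Proof. by rewrite mem_undup; apply: map_f; rewrite mem_enum. Qed.

Lemma fullv_lattice : fullv \in lattice.
Proof. by have := mem_lattice set0; rewrite big_set0. Qed.

Lemma hyp_lattice i : A i \in lattice.
Proof. by have := mem_lattice [set i]; rewrite big_set1. Qed.

Lemma codim_hyp i : codim (A i) = 1%N.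
Proof. by rewrite /codim -[X in (X - _)%N](hyp_dim A i) subSnn. Qed.

Lemma lattice_codim1 Y : Y \in lattice -> codim Y = 1%N -> exists i, Y = A i.
Proof.
rewrite mem_undup => /mapP[J _ ->].
have [->|[i iJ]] := set_0Vmem J; first by rewrite big_set0 codim_fullv.
move=> c1; exists i; apply/eqP; apply: contra_eqT c1 => ne.
suff: (1 < codim (\bigcap_(i in J) A i))%N by case: ltngtP.
rewrite -{1}(codim_hyp i); apply: codim_ltn; last by rewrite eq_sym.
by rewrite (bigD1 i) //= capvSl.
Qed.

Lemma mobius_hyp i : mobius (A i) = -1.
Proof.
have nf : A i != fullv by rewrite -codim_eq0 codim_hyp.
rewrite mobius_neq // (eq_bigl (pred1 fullv)); last first.
  move=> Y /=; apply/andP/eqP => [[s nY]|->]; last by rewrite subvf eq_sym.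
  by apply/eqP; rewrite -codim_eq0 -leqn0 -ltnS -(codim_hyp i) codim_ltn.
rewrite -big_filter filter_pred1_uniq ?undup_uniq ?fullv_lattice //.
by rewrite big_seq1 mobius_fullv.
Qed.

Lemma mobius_rank2 X : X \in rank2 ->
  mobius X = #|[set i | (X <= A i)%VS]|%:Z - 1.
Proof.
rewrite mem_filter => /andP[/eqP cX _].
have nf : X != fullv by rewrite -codim_eq0 cX.
rewrite mobius_neq // -big_filter.
rewrite (perm_big (fullv :: [seq A i | i in [set i | (X <= A i)%VS]])) /=.
  rewrite big_cons mobius_fullv big_image /=.
  rewrite (eq_bigr (fun=> -1)) => [|i _]; last exact: mobius_hyp.
  by rewrite sumr_const mulNrn opprB natz.
apply: uniq_perm.
- by rewrite filter_uniq // undup_uniq.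
- rewrite /= map_inj_uniq ?enum_uniq ?andbT; last exact: hyp_inj.
  by apply/mapP => -[i _ /esym/eqP]; rewrite -codim_eq0 codim_hyp.
move=> Y; rewrite mem_filter inE; apply/idP/idP => [|].
  move=> /andP[/andP[sXY nYX] YL].
  have := codim_ltn sXY nYX; rewrite cX.
  case cY: (codim Y) => [|[|//]] _; first by rewrite -codim_eq0 cY.
  have [i eY] := lattice_codim1 YL cY; apply/orP; right.
  by apply/mapP; exists i; rewrite // mem_enum inE -eY.
case/orP => [/eqP ->|/imageP [j jX ->]]; first by rewrite subvf eq_sym nf fullv_lattice.
move: jX; rewrite inE => sX; rewrite sX hyp_lattice andbT /=.
by apply/eqP => e; rewrite -e codim_hyp in cX.
Qed.

End Arrangement.

Section OrlikSolomon.
Variables (C : fieldType) (l n : nat) (k : fieldType) (A : arrangement C l n).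

Definition os_relations : seq (ext k n) :=
  [seq eder (ebasis k J) | J : {set 'I_n} <- enum {set 'I_n}
                         & (codim (\bigcap_(i in J) A i) < #|J|)%N].

(* The two-sided ideal generated by the relations; the Orlik-Solomon algebra is
   its quotient, whose elements are handled through representatives. *)
Definition os_ideal : {vspace ext k n} :=
  (fullv * <<os_relations>> * fullv)%VS.

(* Representatives in [E_p] of the cocycles and of the coboundaries of degree
   [p] of the Orlik-Solomon algebra with differential [x |-> x * a]. *)
Definition os_cocycles (a : ext k n) (p : int) : {vspace ext k n} :=
  (extdeg k n p :&: amulr a @^-1: os_ideal)%VS.

Definition os_coboundaries (a : ext k n) (p : int) : {vspace ext k n} :=
  (extdeg k n p :&: (amulr a @: extdeg k n (p - 1) + os_ideal))%VS.

Definition resonance1 : {pred ext k n} :=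
  [pred a | (a \in extdeg k n 1)
            && ~~ (os_cocycles a 1 <= os_coboundaries a 1)%VS].

Definition MLS : Prop :=
  is_betti os_ideal 2 3
    (2 * \sum_(X <- rank2 A) 'C(`|(mobius A X + 1)%R|, 3))%N.

Definition in_local_component (X : {vspace 'rV[C]_l}) (a : ext k n) : Prop :=
  exists2 c : 'I_n -> k, \sum_(i | (X <= A i)%VS) c i = 0
    & a = \sum_(i | (X <= A i)%VS) c i *: egen k i.

End OrlikSolomon.

(* Main.v *)
(* The space of linear syzygies of the Orlik-Solomon ideal I, i.e. the kernel of
   [E_1 (x) I_2 -> E_3], embeds in [Tor_2(E/I, k)_3].  Every triple [T] of
   hyperplanes containing a common rank 2 flat gives the two linear syzygies
   [(e_i - e_t) (x) d e_T], where [t] is a fixed element of [T] and [i] runs over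
   the two others, because [e_i d e_T = e_T] for [i] in [T].  These local
   syzygies are free and their number is the one in the definition of MLS, so
   under MLS they span all linear syzygies.  If [x a] lies in [I] with [x] not
   proportional to [a], then [a (x) x a] is a linear syzygy, hence a combination
   of local ones.  Fix [J] such that [x a] has a nonzero coefficient at [e_J]:
   only the triples of one flat [X] contribute to [e_J], and comparing the
   coefficients of [e_J] puts [a] in the local component of [X]. *)
From HB Require Import structures.
Require Import Defs.
From mathcomp Require Import all_boot all_order all_algebra all_field reals.
From mathcomp.real_closed Require Import complex.

Import Order.TTheory GRing.Theory Num.Theory.

Local Open Scope ring_scope.

Set Implicit Arguments.
Unset Strict Implicit.
Unset Printing Implicit Defensive.

(** * Coefficients of products and homogeneous parts in the exterior algebra *)

Section ExteriorCoefficients.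
Variables (k : fieldType) (n : nat).
Implicit Types (x y : ext k n) (J K L : {set 'I_n}) (i j : 'I_n).

Lemma wedgeE x y L : (x * y) L =
  \sum_(J : {set 'I_n} | J \subset L)
     (-1) ^+ crossings J (L :\: J) * (x J * y (L :\: J)).
Proof. by rewrite [LHS]ffunE. Qed.

Lemma ecounitM x y : ecounit (x * y) = ecounit x * ecounit y.
Proof.
rewrite /ecounit wedgeE (bigD1 set0) //= setD0 crossings0l mul1r big1 ?addr0 //.
by move=> J; rewrite subset0 => /andP[/eqP ->]; rewrite eqxx.
Qed.

Lemma wedge_coef1 x y i :
  (x * y) [set i] = x set0 * y [set i] + x [set i] * y set0.
Proof.
rewrite wedgeE (bigD1 set0) ?sub0set //= setD0 crossings0l mul1r; congr (_ + _).
rewrite (bigD1 [set i]) /=; last first.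
  by rewrite subxx; apply/eqP => /setP/(_ i); rewrite !inE eqxx.
rewrite setDv crossings0r mul1r big1 ?addr0 // => J /andP[/andP[]].
by rewrite subset1 => /orP[] /eqP -> //; rewrite eqxx.
Qed.

Lemma ecounit_gen i : ecounit (egen k i) = 0.
Proof.
rewrite /ecounit /egen ebasisE; case: eqP => // /setP/(_ i).
by rewrite !inE eqxx.
Qed.

Lemma egen_coef i j : egen k i [set j] = (i == j)%:R.
Proof. by rewrite /egen ebasisE (inj_eq set1_inj) eq_sym. Qed.

Lemma scalar_coef (c : k) J : (c%:A : ext k n) J = c * (J == set0)%:R.
Proof. by rewrite extZE [(1 : ext k n) J]ebasisE. Qed.

Lemma scalar_deg (c : k) : (c%:A : ext k n) \in extdeg k n 0.
Proof.
apply/mem_extdeg => J; rewrite scalar_coef.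
by case: (J =P set0) => [-> _|_]; rewrite ?cards0 // mulr0 eqxx.
Qed.

Lemma egen_deg i : egen k i \in extdeg k n 1.
Proof.
apply/mem_extdeg => J; rewrite /egen ebasisE.
by case: (J =P [set i]) => [-> _|_]; rewrite ?cards1 // eqxx.
Qed.

Lemma extdeg_coef (p : int) x J : x \in extdeg k n p -> #|J|%:Z != p -> x J = 0.
Proof. by move=> /mem_extdeg xp; apply: contra_neq_eq => /xp. Qed.

Definition hpart (p : int) x : ext k n :=
  [ffun J : {set 'I_n} => if #|J|%:Z == p then x J else 0].

Lemma hpartE p x J : hpart p x J = if #|J|%:Z == p then x J else 0.
Proof. exact: ffunE. Qed.

Lemma hpart_deg p x : hpart p x \in extdeg k n p.
Proof. by apply/mem_extdeg => J; rewrite hpartE; case: ifP => [/eqP //|_]; rewrite eqxx. Qed.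

Lemma hpart_id p x : x \in extdeg k n p -> hpart p x = x.
Proof.
move=> xp; apply/ffunP => J; rewrite hpartE; case: (boolP (_ == _)) => // np.
by rewrite (extdeg_coef xp).
Qed.

Fact hpart_is_linear p : linear (hpart p).
Proof.
move=> c x y; apply/ffunP => J; rewrite !(extE, hpartE).
by case: ifP => // _; rewrite mulr0 addr0.
Qed.

HB.instance Definition _ p :=
  GRing.isLinear.Build k (ext k n) (ext k n) _ (hpart p) (hpart_is_linear p).

(** A coefficient [y (L :\: J)] can be nonzero only if [J] has [q] elements fewer than [L]. As [x]
    is arbitrary, this makes homogeneous matrices commute with taking components of rows. *)
Lemma hpartM p q x y :
  y \in extdeg k n q -> hpart p (x * y) = hpart (p - q) x * y.
Proof.
move=> yq; apply/ffunP => L; rewrite hpartE !wedgeE.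
have E J : J \subset L -> y (L :\: J) != 0 -> (#|L|%:Z == p) = (#|J|%:Z == p - q).
  move=> sJL /(mem_extdeg _ _ yq) <-; rewrite cardsD (setIidPr sJL).
  by rewrite -subzn ?subset_leq_card // [RHS]eq_sym subr_eq addrC subrK eq_sym.
case: ifPn => Lp; last rewrite big1 //; last first.
  move=> J sJL; rewrite hpartE; have [->|nz] := eqVneq (y (L :\: J)) 0.
    by rewrite !mulr0.
  by rewrite -(E J) // (negPf Lp) mul0r mulr0.
apply: eq_bigr => J sJL; rewrite hpartE.
have [->|nz] := eqVneq (y (L :\: J)) 0; first by rewrite !mulr0.
by rewrite -(E J) // Lp.
Qed.

Lemma extdegM p q x y :
  x \in extdeg k n p -> y \in extdeg k n q -> x * y \in extdeg k n (p + q).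
Proof.
by move=> xp yq; rewrite -(hpart_id xp) -{1}(addrK q p) -hpartM // hpart_deg.
Qed.

End ExteriorCoefficients.

(** * Linear syzygies embed in Tor *)

Section LinearSyzygies.
Variables (k : fieldType) (n : nat).
Implicit Types (I : {vspace ext k n}) (w : {ffun 'I_n -> ext k n}).

(* [w] stands for the tensor [\sum_i e_i (x) w i]. *)
Definition linear_syzygy I w :=
  (forall i, (w i \in I) && (w i \in extdeg k n 2))
  /\ \sum_i egen k i * w i = 0.

Lemma map_ecounitM m p q (M : 'M[ext k n]_(m, p)) (N : 'M[ext k n]_(p, q)) :
  map_mx (@ecounit k n) (M *m N) = map_mx (@ecounit k n) M *m map_mx (@ecounit k n) N.
Proof.
apply/matrixP => i j; rewrite !mxE.
rewrite /ecounit ext_sumE; apply: eq_bigr => s _.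
by rewrite !mxE; apply: ecounitM.
Qed.

(** The component of total degree [p] in the graded free module whose generators have degrees
    [g]. *)
Definition hrow (p : int) m (g : 'I_m -> int) (v : 'rV[ext k n]_m) :=
  \row_s hpart (p - g s) (v ord0 s).

Definition homog (p : int) m (g : 'I_m -> int) (v : 'rV[ext k n]_m) :=
  forall s, v ord0 s \in extdeg k n (p - g s).

Lemma hrow_homog p m (g : 'I_m -> int) v : homog p g (hrow p g v).
Proof. by move=> s; rewrite mxE hpart_deg. Qed.

Lemma hrow_id p m (g : 'I_m -> int) v : homog p g v -> hrow p g v = v.
Proof. by move=> hv; apply/rowP => s; rewrite mxE hpart_id. Qed.

Lemma homogZ p q m (g : 'I_m -> int) (x : ext k n) v :
  x \in extdeg k n p -> homog q g v -> homog (p + q) g (x *: v).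
Proof. by move=> xp hv s; rewrite mxE -addrA; apply: extdegM. Qed.

Lemma homog_sum p m (g : 'I_m -> int) (J : finType) (v : J -> 'rV_m) :
  (forall j, homog p g (v j)) -> homog p g (\sum_j v j).
Proof. by move=> hv s; rewrite summxE; apply: memv_suml => j _; apply: hv. Qed.

Lemma hrowM p m r (g : 'I_m -> int) (h : 'I_r -> int) (M : 'M_(m, r)) v :
  (forall s t, M s t \in extdeg k n (g s - h t)) ->
  hrow p h (v *m M) = hrow p g v *m M.
Proof.
move=> hM; apply/rowP => t; rewrite !mxE linear_sum; apply: eq_bigr => s _.
by rewrite /= mxE (hpartM _ _ (hM s t)) opprB addrA subrK.
Qed.

Lemma homogM p m r (g : 'I_m -> int) (h : 'I_r -> int) (M : 'M_(m, r)) v :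
  (forall s t, M s t \in extdeg k n (g s - h t)) ->
  homog p g v -> homog p h (v *m M).
Proof. by move=> hM hv; rewrite -(hrow_id hv) -(hrowM _ _ hM); apply: hrow_homog. Qed.

Section Resolution.
Variables (I : {vspace ext k n}) (F : graded_free_resolution I).
Hypothesis I_deg : forall x (J : {set 'I_n}), x \in I -> (#|J| < 2)%N -> x J = 0.

Let g i : 'I_(rk F i) -> int := @gdeg k n I F i.

Lemma diffK i : diff F i.+1 *m diff F i = 0.
Proof.
apply/row_matrixP => s; rewrite row_mul row0.
by apply/diff_exact; exists (delta_mx 0 s); rewrite rowE.
Qed.

(** Exactness provides a lift without control of degrees; since the differential is homogeneous, the
    component of degree [p] of that lift still lifts [v]. *)
Lemma homog_lift_aug p (v : 'rV_(rk F 0)) : homog p (@g 0) v ->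
  (v *m aug F) ord0 ord0 \in I ->
  exists2 u, homog p (@g 1) u & v = u *m diff F 0.
Proof.
move=> hv /aug_exact[u ev]; exists (hrow p (@g 1) u); first exact: hrow_homog.
by rewrite -(hrowM _ (h := @g 0)) -?ev ?hrow_id //; apply: diff_homog.
Qed.

Lemma homog_lift p i (v : 'rV_(rk F i.+1)) : homog p (@g i.+1) v ->
  v *m diff F i = 0 ->
  exists2 u, homog p (@g i.+2) u & v = u *m diff F i.+1.
Proof.
move=> hv /diff_exact[u ev]; exists (hrow p (@g i.+2) u); first exact: hrow_homog.
by rewrite -(hrowM _ (h := @g i.+1)) -?ev ?hrow_id //; apply: diff_homog.
Qed.

(** Surjectivity reaches 1 only modulo [I]; passing to degree 0, where [I] vanishes, removes the
    error term. *)
Lemma aug_unit : exists2 v, homog 0 (@g 0) v & (v *m aug F) ord0 ord0 = 1.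
Proof.
have [v0 hv0] := aug_onto F 1.
exists (hrow 0 (@g 0) v0); first exact: hrow_homog.
have -> : (hrow 0 (@g 0) v0 *m aug F) ord0 ord0 = hpart 0 ((v0 *m aug F) ord0 ord0).
  rewrite !mxE linear_sum; apply: eq_bigr => s _.
  by rewrite /= mxE (hpartM _ _ (aug_homog s)).
rewrite -[X in hpart 0 X](subrK 1) linearD /= (hpart_id (x := 1)); last first.
  by rewrite -(scale1r 1) scalar_deg.
rewrite (_ : hpart _ _ = 0) ?add0r //.
apply/ffunP => J; rewrite hpartE ext0E; case: eqP => // /eqP.
by rewrite eqz_nat => /eqP J0; rewrite (I_deg hv0) ?J0.
Qed.

(** The entry at [s] has degree [p - g s], so its constant term vanishes unless [g s = p]; the
    diagonal matrix [kstrand] therefore fixes the image of [v]. *)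
Lemma homog_strand p i (v : 'rV_(rk F i)) : homog p (@g i) v ->
  (map_mx (@ecounit k n) v <= kstrand F i p)%MS.
Proof.
move=> hv; apply/submxP; exists (map_mx (@ecounit k n) v).
apply/rowP => s; rewrite mul_mx_diag !mxE.
case: eqP => gs; rewrite ?mulr1 // mulr0.
rewrite /ecounit (extdeg_coef (hv s)) // cards0 eq_sym subr_eq0.
by apply/eqP => e; apply: gs.
Qed.

(* The comparison with the Cartan resolution: [w] lifts through [F_1] to [u] in
   [F_2], whose image in [k (x)_E F_2] represents the class of [w] in Tor. *)
Definition syzygy_lift v1 w (u : 'rV_(rk F 2)) := exists y : 'I_n -> 'rV_(rk F 1),
  [/\ forall i, w i *: v1 = y i *m diff F 0,
      \sum_i egen k i *: y i = u *m diff F 1 & homog 3 (@g 2) u].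

(** Two successive lifts: [w i *: v1] augments to [w i], which is in [I], hence comes from some
    [y i]; then the sum of the [e_i y_i] is a cycle because the sum of the [e_i w_i] is zero. *)
Lemma syzygy_lift_exists v1 w : homog 0 (@g 0) v1 -> (v1 *m aug F) ord0 ord0 = 1 ->
  linear_syzygy I w -> exists u, syzygy_lift v1 w u.
Proof.
move=> hv1 av1 [wI w0].
have /fin_all_exists[y hy] i :
    exists y, homog 2 (@g 1) y /\ w i *: v1 = y *m diff F 0.
  have /andP[wiI wi2] := wI i.
  have [||y] := @homog_lift_aug 2 (w i *: v1).
  - by rewrite -[2]addr0; apply: homogZ.
  - by rewrite -scalemxAl mxE av1 mulr1.
  by exists y.
have [||u hu eu] := @homog_lift 3 0 (\sum_i egen k i *: y i).
- apply: homog_sum => i; rewrite -[3]/(1 + 2 : int); apply: homogZ (egen_deg _ _) _.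
  by have [] := hy i.
- rewrite mulmx_suml (eq_bigr (fun i => (egen k i * w i) *: v1)).
    by rewrite -scaler_suml w0 scale0r.
  by move=> i _; rewrite -scalemxAl -(hy i).2 scalerA.
by exists u; exists y; split=> // i; have [] := hy i.
Qed.

(** Turns a linear relation between classes in Tor into a statement about a lift of a single
    syzygy. *)
Lemma syzygy_lift_sum v1 (J : finType) (c : J -> k)
    (w : J -> {ffun 'I_n -> ext k n}) (u : J -> 'rV_(rk F 2)) :
  (forall j, syzygy_lift v1 (w j) (u j)) ->
  syzygy_lift v1 (\sum_j c j *: w j) (\sum_j (c j)%:A *: u j).
Proof.
move=> /fin_all_exists[y hy]; exists (fun i => \sum_j (c j)%:A *: y j i); split.
- move=> i; rewrite mulmx_suml sum_ffunE scaler_suml; apply: eq_bigr => j _.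
  have [e _ _] := hy j.
  by rewrite -scalemxAl -e scalerA ffunE -scalerAl mul1r.
- rewrite mulmx_suml; under eq_bigr do rewrite scaler_sumr.
  rewrite exchange_big; apply: eq_bigr => j _ /=.
  have [_ e _] := hy j; rewrite -scalemxAl -e scaler_sumr.
  apply: eq_bigr => i _; rewrite !scalerA.
  by rewrite -scalerAl -scalerAr mul1r mulr1.
apply: homog_sum => j; rewrite -[3]add0r; apply: homogZ (scalar_deg _ _) _.
by have [] := hy j.
Qed.

(** The differential of [u] is a combination of the [e_i], all killed by the counit. *)
Lemma syzygy_lift_cycle v1 w u : syzygy_lift v1 w u ->
  (map_mx (@ecounit k n) u <= kstrand F 2 3 :&: kermx (kdiff_out F 2))%MS.
Proof.
case=> y [_ e hu]; rewrite sub_capmx (homog_strand hu).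
apply/sub_kermxP; rewrite /= /kdiff_in -map_ecounitM -e.
apply/rowP => s; rewrite !mxE /ecounit summxE ext_sumE big1 // => i _.
by rewrite mxE; apply: etrans (ecounitM _ _) _; rewrite ecounit_gen mul0r.
Qed.

(** This inclusion makes the truncated subtraction in [tor_dim] a true dimension of homology. *)
Lemma boundary_cycle :
  (kstrand F 3 3 *m kdiff_in F 2 <= kstrand F 2 3 :&: kermx (kdiff_out F 2))%MS.
Proof.
apply/row_subP => s; rewrite row_mul.
set z0 := row s (kstrand F 3 3).
(* The row over [k] is lifted to constants of [E], where the composite of two differentials is known
   to vanish. *)
pose z : 'rV[ext k n]_(rk F 3) := \row_t (z0 ord0 t)%:A.
have zz : z0 = map_mx (@ecounit k n) z.
  by apply/rowP => t; rewrite !mxE /ecounit scalar_coef eqxx mulr1.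
have hz : homog 3 (@g 3) z.
  move=> t; rewrite !mxE; case: (s =P t) => [->|_]; last first.
    by rewrite mulr0n scale0r mem0v.
  rewrite mulr1n; case: eqP => gt; last by rewrite scale0r mem0v.
  by rewrite /g gt subrr scalar_deg.
rewrite zz /kdiff_in -map_ecounitM sub_capmx homog_strand /=; last first.
  by apply: homogM hz; apply: diff_homog.
apply/sub_kermxP; rewrite -map_ecounitM -mulmxA diffK mulmx0.
by apply/rowP => t; rewrite !mxE /ecounit ext0E.
Qed.

(* If [u] is a boundary modulo [E_+], it may be taken in [E_+ F_2]; subtracting
   from [y i] the boundary of the coefficient of [e_i] in [u] leaves [x i] in
   [E_+ F_1], with the same image [w i] in [I]; but [E_+ I] has no component of
   degree 2. *)
Lemma syzygy_lift_boundary v1 w u :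
  (v1 *m aug F) ord0 ord0 = 1 -> (forall i, w i \in extdeg k n 2) ->
  syzygy_lift v1 w u ->
  (map_mx (@ecounit k n) u <= kstrand F 3 3 *m kdiff_in F 2)%MS -> w = 0.
Proof.
move=> av1 w2 [y [ey e hu]] /submxP[z0 ez].
pose z : 'rV[ext k n]_(rk F 3) := \row_t ((z0 *m kstrand F 3 3) ord0 t)%:A.
pose u' := u - z *m diff F 2.
have u'0 t : u' ord0 t set0 = 0.
  have zz : z0 *m kstrand F 3 3 = map_mx (@ecounit k n) z.
    apply/rowP => s; rewrite [RHS]mxE /ecounit [z _ _]mxE scalar_coef.
    by rewrite eqxx mulr1.
  rewrite mulmxA zz -map_ecounitM in ez.
  have /rowP/(_ t) := ez; rewrite [LHS]mxE [RHS]mxE /ecounit => et.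
  by rewrite !mxE !extE et [X in _ - X]/= mxE subrr.
have e' : \sum_i egen k i *: y i = u' *m diff F 1.
  by rewrite mulmxBl -mulmxA diffK mulmx0 subr0.
pose u1 i : 'rV[ext k n]_(rk F 2) := \row_t (u' ord0 t [set i] : k)%:A.
have u1E i t : u1 i ord0 t = (u' ord0 t [set i] : k)%:A by rewrite mxE.
pose x i : 'rV_(rk F 1) := y i - u1 i *m diff F 1.
have x0 i s : x i ord0 s set0 = 0.
  (* The coefficient of [e_i] in [e'] is the constant term of [y i] on the left; on the right, as
     [u'] has no constant term, it is the constant term of [u1 i *m diff F 1]. *)
  have /rowP/(_ s) := e'; rewrite summxE mxE => /(congr1 (fun b : ext k n => b [set i])).
  rewrite !ext_sumE (bigD1 i) //= big1 ?addr0; last first.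
    move=> j ji; rewrite mxE wedge_coef1 [egen k j set0]ecounit_gen egen_coef.
    by rewrite (negPf ji) !mul0r addr0.
  rewrite mxE wedge_coef1 [egen k i set0]ecounit_gen egen_coef eqxx mul0r add0r mul1r.
  move=> eyi; rewrite mxE extDE eyi mxE extNE mxE ext_sumE.
  rewrite -sumrB big1 // => t _.
  by rewrite wedge_coef1 u'0 mul0r add0r u1E -scalerAl mul1r extZE subrr.
have ex i : w i *: v1 = x i *m diff F 0.
  by rewrite mulmxBl -mulmxA diffK mulmx0 subr0.
have rI s : (row s (diff F 0) *m aug F) ord0 ord0 \in I.
  by apply/aug_exact; exists (delta_mx 0 s); rewrite rowE.
apply/ffunP => i; apply/ffunP => J; rewrite ffunE ext0E.
have [J2|/extdeg_coef] := boolP (#|J|%:Z == 2); last exact.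
(* Applying the augmentation to [ex] writes [w i] as a combination of elements of [I] with
   coefficients in [E_+]. *)
have -> : w i = \sum_s x i ord0 s * (row s (diff F 0) *m aug F) ord0 ord0.
  have -> : w i = ((w i *: v1) *m aug F) ord0 ord0.
    by rewrite -scalemxAl mxE av1 mulr1.
  rewrite ex -mulmxA mxE; apply: eq_bigr => s _.
  by rewrite -row_mul [row _ _ _ _]mxE.
rewrite ext_sumE big1 // => s _; rewrite wedgeE big1 // => K sKJ.
have [->|[j jK]] := set_0Vmem K; first by rewrite x0 mul0r mulr0.
rewrite (I_deg (rI s)) ?mulr0 ?mulr0 //.
have -> : 2%N = #|J| by apply/eqP; rewrite eq_sym -eqz_nat.
apply: proper_card; rewrite properEneq subsetDl andbT.
apply: contraTneq jK => eJ; have := subsetP sKJ j.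
by rewrite -{1}eJ inE; case: (j \in K) => // /(_ isT).
Qed.

(** A basis of [U] is lifted to cycles that are independent modulo boundaries. The resolution is
    arbitrary, so the bound applies to whichever one computes the Betti number. *)
Lemma syzygy_dim_le_tor (U : {vspace {ffun 'I_n -> ext k n}}) :
  (forall w, w \in U -> linear_syzygy I w) -> (\dim U <= tor_dim F 2 3)%N.
Proof.
move=> hU; have [v1 hv1 av1] := aug_unit.
have /fin_all_exists[u hu] (j : 'I_(\dim U)) : exists u, syzygy_lift v1 (vbasis U)`_j u.
  apply: syzygy_lift_exists => //; apply: hU.
  by apply: vbasis_mem; rewrite mem_nth // size_tuple.
pose B : 'M[k]_(\dim U, rk F 2) := \matrix_j map_mx (@ecounit k n) (u j).
set N := kstrand F 3 3 *m kdiff_in F 2.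
set Z := (kstrand F 2 3 :&: kermx (kdiff_out F 2))%MS.
have BZ : (B <= Z)%MS.
  by apply/row_subP => j; rewrite rowK; apply: syzygy_lift_cycle (hu j).
have BN (c : 'rV_(\dim U)) : (c *m B <= N)%MS -> c = 0.
  move=> cN; have hc := syzygy_lift_sum (fun j => c ord0 j) hu.
  have := syzygy_lift_boundary av1 _ hc.
  have -> : map_mx (@ecounit k n) (\sum_j (c ord0 j)%:A *: u j) = c *m B.
    apply/rowP => s; rewrite !mxE /ecounit summxE ext_sumE; apply: eq_bigr => j _.
    by rewrite !mxE -scalerAl mul1r extZE.
  move/(_ _ cN) => w0; apply/rowP => j; rewrite mxE.
  have /freeP := basis_free (vbasisP U); apply; apply: w0 => i.
  rewrite sum_ffunE; apply: memv_suml => m _; rewrite ffunE; apply: memvZ.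
  have /hU[/(_ i)/andP[]//] : (vbasis U)`_m \in U.
  by apply: vbasis_mem; rewrite mem_nth // size_tuple.
have rB : \rank B = \dim U.
  by apply/eqP/inj_row_free => c c0; apply: BN; rewrite c0 sub0mx.
have cap0 : \rank (B :&: N)%MS = 0%N.
  apply/eqP; rewrite mxrank_eq0; apply/eqP/row_matrixP => j; rewrite row0.
  have := row_sub j (B :&: N)%MS; rewrite sub_capmx => /andP[/submxP[c ->]].
  by move/BN => ->; rewrite mul0mx.
rewrite /tor_dim -/Z -/N leq_subRL ?mxrankS ?boundary_cycle //.
rewrite -rB addnC -mxrank_sum_cap cap0 addn0; apply: mxrankS.
by rewrite addsmx_sub BZ boundary_cycle.
Qed.

End Resolution.
End LinearSyzygies.

(** * Elements of degree one, boundaries of basis elements, and the ideal [E_(>= 2)] *)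

Section DegreeOne.
Variables (k : fieldType) (n : nat).
Implicit Types (x y a : ext k n) (J T : {set 'I_n}) (i j : 'I_n).

(** Up to the sign that sorts [i] and [j], this is a 2 by 2 minor of the degree one coefficients. *)
Lemma wedge_coef2 x y i j :
  x \in extdeg k n 1 -> i != j ->
  (x * y) [set i; j] = (-1) ^+ (j < i)%N *
    (x [set i] * y [set j] - x [set j] * y [set i]).
Proof.
move=> x1 nij.
have nij1 : [set j] != [set i] by rewrite (inj_eq set1_inj) eq_sym.
have Di : [set i; j] :\ i = [set j].
  by apply/setP => m; rewrite !inE; case: eqP => // ->; rewrite (negPf nij).
have Dj : [set i; j] :\ j = [set i].
  by apply/setP => m; rewrite !inE orbC; case: eqP => // ->; rewrite eq_sym (negPf nij).
rewrite wedgeE (bigD1 [set i]) ?sub1set ?set21 //=.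
rewrite (bigD1 [set j]) ?sub1set ?set22 //= big1 ?addr0; last first.
  move=> J /andP[/andP[sJ Ji] Jj]; suff -> : x J = 0 by rewrite mul0r mulr0.
  apply: (extdeg_coef x1); apply: contraNN Jj; rewrite eqz_nat => /cards1P[m eJ].
  move: sJ Ji; rewrite eJ sub1set !inE (inj_eq set1_inj) => /orP[]/eqP ->.
    by rewrite eqxx.
  by rewrite eqxx.
rewrite Di Dj /crossings !big_set1 mulrBr; congr (_ + _); rewrite -mulrN.
rewrite -mulNr; move: nij; rewrite -val_eqE /=.
by case: ltngtP => //= _ _; rewrite ?expr1 ?expr0 !mulN1r ?mul1r ?mulN1r ?mulrN ?mulNr ?opprK.
Qed.

Lemma degree1_sqr x : x \in extdeg k n 1 -> x * x = 0.
Proof.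
move=> x1; apply/ffunP => L; rewrite ext0E.
have [/eqP L2|] := boolP (#|L|%:Z == 2); last first.
  by move=> L2; apply: (extdeg_coef (extdegM x1 x1)) L2.
have /cards2P[i [j [nij ->]]] : #|L| == 2%N by rewrite -eqz_nat L2.
by rewrite wedge_coef2 // [X in _ - X]mulrC subrr mulr0.
Qed.

Lemma degree1_anticomm x y : x \in extdeg k n 1 -> y \in extdeg k n 1 ->
  y * x = - (x * y).
Proof.
move=> x1 y1; apply/eqP; rewrite -addr_eq0 addrC; apply/eqP.
have := degree1_sqr (memvD x1 y1).
by rewrite mulrDl !mulrDr !degree1_sqr // add0r addr0.
Qed.

Lemma degree1_sum x : x \in extdeg k n 1 -> x = \sum_i x [set i] *: egen k i.
Proof.
move=> x1; apply/ffunP => J; rewrite ext_sumE.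
have [/cards1P[i ->]|J1] := boolP (#|J| == 1%N).
  rewrite (bigD1 i) //= big1 ?addr0; first by rewrite extZE egen_coef eqxx mulr1.
  by move=> j ji; rewrite extZE egen_coef (negPf ji) mulr0.
rewrite (extdeg_coef x1) ?eqz_nat // big1 // => i _.
by rewrite extZE (extdeg_coef (egen_deg _ _)) ?mulr0 ?eqz_nat.
Qed.

Lemma degree1_mul_eq0 x a : x \in extdeg k n 1 -> a \in extdeg k n 1 ->
  a != 0 -> x * a = 0 -> exists c : k, x = c *: a.
Proof.
move=> x1 a1 a0 xa0.
have [i ai] : exists i, a [set i] != 0.
  apply/existsP; apply: contraNT a0 => /existsPn a0; rewrite (degree1_sum a1).
  by rewrite big1 // => i _; have /negPn/eqP -> := a0 i; rewrite scale0r.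
(* With the pivot [a [set i]], the vanishing of the minors on columns [i] and [j] determines every
   other coefficient of [x]. *)
exists (x [set i] / a [set i]); rewrite [LHS](degree1_sum x1) [X in _ *: X](degree1_sum a1).
rewrite scaler_sumr; apply: eq_bigr => j _; rewrite scalerA; congr (_ *: _).
have [<-|nij] := eqVneq i j; first by rewrite (divfK ai).
have /eqP := wedge_coef2 a x1 nij.
rewrite xa0 ext0E eq_sym mulf_eq0 signr_eq0 subr_eq0 => /eqP e.
by rewrite mulrAC e (mulfK ai).
Qed.

Lemma eder_basis_coef T J : eder (ebasis k T) J != 0 ->
  exists2 m, m \in T & J = T :\ m.
Proof.
move=> nz; apply/'exists_in_eqP; apply: contraNT nz => /exists_inPn nT.
rewrite eder_basis ext_sumE big1 // => m mT; rewrite !extE.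
by rewrite (negPf (nT m mT)) mulr0.
Qed.

Lemma eder_basis_coefD1 T m : m \in T -> eder (ebasis k T) (T :\ m) != 0.
Proof.
move=> mT; rewrite eder_basis ext_sumE (bigD1 m) //= big1 ?addr0.
  by rewrite !extE eqxx mulr1 signr_eq0.
move=> j /andP[jT jm]; rewrite !extE; case: eqP; rewrite ?mulr0 //.
by move/setP/(_ j); rewrite !inE jT jm eqxx.
Qed.

(** Apply the Leibniz rule to [e_i e_T = 0]. *)
Lemma gen_eder_basis T i : i \in T -> egen k i * eder (ebasis k T) = ebasis k T.
Proof.
move=> iT; have /eqP := eder_genM i (ebasis k T).
rewrite ebasisM disjoints1 iT linear0 eq_sym subr_eq0.
by move/eqP.
Qed.

Lemma eder_basis_deg T : #|T| = 3%N -> eder (ebasis k T) \in extdeg k n 2.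
Proof.
move=> T3; apply/mem_extdeg => J /eder_basis_coef[m mT ->].
by move: T3; rewrite (cardsD1 m) mT add1n => -[->].
Qed.

(** As a subspace stable under both multiplications, it can be compared with the products of
    subspaces defining [os_ideal]. *)
Definition deg_ge2 : {vspace ext k n} :=
  (lker (linfun (@hpart k n 0)) :&: lker (linfun (@hpart k n 1)))%VS.

Lemma deg_ge2P x :
  reflect (forall J, (#|J| < 2)%N -> x J = 0) (x \in deg_ge2).
Proof.
rewrite memv_cap !memv_ker !lfunE; apply: (iffP andP) => /= [[/eqP x0 /eqP x1] J|x0].
  case J01: #|J| => [|[|]] // _.
    by have := congr1 (fun y : ext k n => y J) x0; rewrite /= hpartE ext0E J01.
  by have := congr1 (fun y : ext k n => y J) x1; rewrite /= hpartE ext0E J01.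
by split; apply/eqP/ffunP => J; rewrite hpartE ext0E; case: eqP => // -[J01];
  rewrite x0 // J01.
Qed.

Lemma deg_ge2_mull x y : y \in deg_ge2 -> x * y \in deg_ge2.
Proof.
move=> /deg_ge2P y0; apply/deg_ge2P => L L2; rewrite wedgeE big1 // => J _.
by rewrite y0 ?mulr0 // (leq_ltn_trans _ L2) // subset_leq_card // subsetDl.
Qed.

Lemma deg_ge2_mulr x y : x \in deg_ge2 -> x * y \in deg_ge2.
Proof.
move=> /deg_ge2P x0; apply/deg_ge2P => L L2; rewrite wedgeE big1 // => J sJL.
by rewrite x0 ?mul0r ?mulr0 // (leq_ltn_trans _ L2) // subset_leq_card.
Qed.

End DegreeOne.

Lemma span_ind (K : fieldType) (V : vectType K) (P : V -> Prop) (X : seq V) :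
  P 0 -> (forall c u v, P u -> P v -> P (c *: u + v)) ->
  {in X, forall v, P v} -> {in <<X>>%VS, forall v, P v}.
Proof.
move=> P0 PD PX v /(@coord_span _ _ _ (in_tuple X)) ->.
apply: (big_ind P) => //= [x y Px Py|i _]; first by rewrite -(scale1r x); apply: PD.
by rewrite -[_ *: _]addr0; apply: PD => //; apply/PX/mem_nth.
Qed.

(** * Rank 2 flats, dependent triples and their local syzygies *)

Section Dependencies.
Variables (C : fieldType) (l n : nat) (k : fieldType) (A : arrangement C l n).
Implicit Types (X Y : {vspace 'rV[C]_l}) (i j : 'I_n) (J T : {set 'I_n})
  (p q : {set 'I_n} * 'I_n) (w : {ffun 'I_n -> ext k n}).

Definition lines X : {set 'I_n} := [set i | (X <= A i)%VS].

Lemma codim_cap_hyp i j : i != j -> (1 < codim (A i :&: A j))%N.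
Proof.
move=> nij; suff: (codim (A i) < codim (A i :&: A j))%N by rewrite codim_hyp.
apply: codim_ltn; first exact: capvSl.
apply: contra nij => /eqP e; apply/eqP/(@hyp_inj _ _ _ A)/eqP.
by rewrite eqEdim {1}e capvSr -ltnS !hyp_dim /=.
Qed.

(** The intersection of the two hyperplanes contains [X] and already has codimension at least 2, so
    the inclusion cannot be strict. *)
Lemma rank2_lines2 X i j : X \in rank2 A -> i != j ->
  i \in lines X -> j \in lines X -> X = (A i :&: A j)%VS.
Proof.
rewrite mem_filter !inE => /andP[/eqP X2 _] nij Xi Xj.
apply/esym/eqP; apply: contraTT (codim_cap_hyp nij) => ne.
suff: (codim (A i :&: A j) < codim X)%N by rewrite X2 -leqNgt.
by apply: codim_ltn => //; rewrite subv_cap Xi.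
Qed.

Lemma rank2_lines_inj X Y J : X \in rank2 A -> Y \in rank2 A -> (1 < #|J|)%N ->
  J \subset lines X -> J \subset lines Y -> X = Y.
Proof.
move=> X2 Y2 /card_gt1P[i [j [iJ jJ nij]]] /subsetP sX /subsetP sY.
by rewrite (rank2_lines2 X2 nij) ?sX // -(rank2_lines2 Y2 nij) ?sY.
Qed.

Definition triples : {set {set 'I_n}} :=
  [set T : {set 'I_n} | (#|T| == 3)%N && has (fun X => T \subset lines X) (rank2 A)].

(** Double counting of the pairs of a flat and a triple through it: a triple lies over at most one
    rank 2 flat. This inequality says that there are at least as many local syzygies as [MLS]
    allows. *)
Lemma sum_bin_lines :
  (\sum_(X <- rank2 A) 'C(#|lines X|, 3) <= #|triples|)%N.
Proof.
under eq_bigr => X _ do rewrite -cards_draws -sum1_card big_mkcond /=.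
rewrite exchange_big -sum1_card [leqRHS]big_mkcond /=; apply: leq_sum => T _.
rewrite -big_mkcond sum1_count; rewrite [T \in _]inE.
case T3: (#|T| == 3%N); last first.
  by rewrite (eq_count (a2 := pred0)) ?count_pred0 // => X /=; rewrite inE T3 andbF.
rewrite (eq_count (a2 := fun X => T \subset lines X)); last first.
  by move=> X; rewrite /= inE T3 andbT.
rewrite has_count; case: (posnP (count _ _)) => [->//|] /= _.
rewrite -size_filter; set s := [seq X <- _ | _].
have us : uniq s by rewrite !filter_uniq // undup_uniq.
(* Two flats [X] and [Y] over the same triple would be equal, against the uniqueness of entries in
   [s]. *)
case es: s us => [|X [|Y s']] //= /andP[]; rewrite inE negb_or => /andP[/eqP[]].
have : X \in s by rewrite es !inE eqxx.
have : Y \in s by rewrite es !inE eqxx orbT.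
rewrite mem_filter => /andP[sY Y2]; rewrite mem_filter => /andP[sX X2].
by apply: rank2_lines_inj sX sY => //; rewrite (eqP T3).
Qed.

Lemma os_relation T : T \in triples -> eder (ebasis k T) \in os_ideal k A.
Proof.
rewrite inE => /andP[/eqP T3 /hasP[X X2 sTX]].
rewrite /os_ideal -[eder _]mulr1 -[eder _]mul1r.
apply: memv_mul; rewrite ?memvf //; apply: memv_mul; rewrite ?memvf //.
apply/memv_span/map_f; rewrite mem_filter mem_enum andbT T3.
move: X2; rewrite mem_filter => /andP[/eqP X2 _].
rewrite ltnS; suff: (codim (\bigcap_(i in T) A i) <= codim X)%N by rewrite X2.
rewrite leq_sub2l // dimvS //.
by apply/subv_bigcapP => i iT; have := subsetP sTX i iT; rewrite inE.
Qed.

Lemma dependent_card T : (codim (\bigcap_(i in T) A i)%VS < #|T|)%N -> (2 < #|T|)%N.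
Proof.
case T0: #|T| => [|[|[|]]] //.
  by have /eqP/cards1P[i ->] := T0; rewrite big_set1 codim_hyp.
have /eqP/cards2P[i [j [nij ->]]] := T0.
by rewrite ltnNge big_setU1 ?inE //= big_set1 codim_cap_hyp.
Qed.

(** At most two distinct hyperplanes are always independent, so every relation comes from a set of
    at least three and lies in the ideal [E_(>= 2)]. *)
Lemma os_ideal_low (x : ext k n) J : x \in os_ideal k A -> (#|J| < 2)%N -> x J = 0.
Proof.
move=> xI J2; apply: (elimT (@deg_ge2P k n x)) J2.
apply: subvP xI; apply/prodvP => y z yV _; apply: deg_ge2_mulr.
apply: subvP yV; apply/prodvP => u v _ vV; apply: deg_ge2_mull.
apply: subvP vV; apply/span_subvP => r /mapP[T].
rewrite mem_filter => /andP[/dependent_card T3 _] ->.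
apply/deg_ge2P => K; apply: contraTeq => /eder_basis_coef[m mT ->].
by rewrite -leqNgt; move: T3; rewrite (cardsD1 m) mT.
Qed.

(** The fixed element of the triple [p.1]. The default [p.2] is taken only when [p.1] is empty, so
    on a triple the choice is independent of [p.2]. *)
Definition apex (p : {set 'I_n} * 'I_n) := odflt p.2 [pick j in p.1].

Definition triple_syzygy (p : {set 'I_n} * 'I_n) : {ffun 'I_n -> ext k n} :=
  [ffun j => ((j == p.2)%:R - (j == apex p)%:R) *: eder (ebasis k p.1)].

Definition triple_index : {set {set 'I_n} * 'I_n} :=
  [set p | [&& p.1 \in triples, p.2 \in p.1 & p.2 != apex p]].

Lemma apex_in p : p.2 \in p.1 -> apex p \in p.1.
Proof. by rewrite /apex; case: pickP. Qed.

Lemma apexE T i j : i \in T -> apex (T, i) = apex (T, j).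
Proof. by move=> iT; rewrite /apex /=; case: pickP => // /(_ i); rewrite iT. Qed.

Lemma card_triple_index : #|triple_index| = (2 * #|triples|)%N.
Proof.
rewrite -sum1_card (eq_bigl (fun p => (p.1 \in triples)
  && ((p.2 \in p.1) && (p.2 != apex p)))) => [|p]; last by rewrite inE.
rewrite -(pair_big_dep (mem triples)
  (fun T i => (i \in T) && (i != apex (T, i))) (fun _ _ => 1%N)) /=.
rewrite mulnC -sum_nat_const; apply: eq_bigr => T; rewrite inE => /andP[/eqP T3 _].
have /card_gt0P[i iT] : (0 < #|T|)%N by rewrite T3.
rewrite (eq_bigl (mem (T :\ apex (T, i)))) ?sum1_card.
  by move: T3; rewrite (cardsD1 (apex (T, i))) (@apex_in (T, i) iT) add1n => -[].
move=> j /=; rewrite !inE andbC; case jT: (j \in T); rewrite ?andbF ?andbT //.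
by rewrite (apexE i jT).
Qed.

Lemma triple_syzygy_coef p j J : p.2 \in p.1 -> triple_syzygy p j J != 0 ->
  [/\ j \in p.1, j = p.2 \/ j = apex p & exists2 m, m \in p.1 & J = p.1 :\ m].
Proof.
move=> pp; rewrite ffunE extZE mulf_eq0 negb_or => /andP[nz /eder_basis_coef ?].
have e : j = p.2 \/ j = apex p.
  move: nz; case: (j =P p.2) => [|_]; first by left.
  by case: (j =P apex p) => [|_]; [right | rewrite subrr eqxx].
by split=> //; case: e => ->; rewrite ?apex_in.
Qed.

Lemma triple_syzygy_linear p : p \in triple_index ->
  linear_syzygy (os_ideal k A) (triple_syzygy p).
Proof.
rewrite inE => /and3P[Tp ip _]; split=> [j|].
  rewrite ffunE !memvZ ?os_relation ?eder_basis_deg //.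
  by move: Tp; rewrite inE => /andP[/eqP].
under eq_bigr do rewrite ffunE scalerBl mulrBr -!scalerAr.
rewrite sumrB (bigD1 p.2) //= eqxx big1 ?addr0 => [|j /negPf ->]; last by rewrite scale0r.
rewrite [X in _ - X](bigD1 (apex p)) //= eqxx big1 ?addr0; last first.
  by move=> j /negPf ->; rewrite scale0r.
by rewrite !scale1r !gen_eder_basis ?apex_in // subrr.
Qed.

(** The coefficients of [e_i - e_t] add up to zero; this is the source of the sum condition in the
    local component. *)
Lemma triple_syzygy_sum p : \sum_j triple_syzygy p j = 0.
Proof.
under eq_bigr do rewrite ffunE; rewrite -scaler_suml sumrB.
have delta i : \sum_j (j == i)%:R = 1 :> k.
  by rewrite (bigD1 i) //= eqxx big1 ?addr0 // => j /negPf ->.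
by rewrite !delta subrr scale0r.
Qed.

(* The coefficients at [(i, T :\ i)] are dual to the family, as [T] is recovered
   as [i |: (T :\ i)]. *)
Lemma triple_syzygy_diag p q : p \in triple_index -> q \in triple_index ->
  (triple_syzygy p q.2 (q.1 :\ q.2) != 0) = (p == q).
Proof.
case: p q => [T i] [T' i']; rewrite !inE /=.
move=> /and3P[/andP[/eqP T3 _] iT ia] /and3P[/andP[/eqP T'3 _] iT' ia'].
apply/idP/eqP => [/triple_syzygy_coef[] //= i'T e [m _ eT]|[-> ->]]; last first.
  rewrite ffunE extZE /= eqxx (negPf ia') subr0 mul1r.
  exact: eder_basis_coefD1.
have eTT : T' = T.
  apply/eqP; rewrite eqEcard T3 T'3 leqnn andbT -(setD1K iT') subUset sub1set i'T.
  by rewrite eT subsetDl.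
case: e => [->|e]; first by rewrite eTT.
by case/negP: ia'; rewrite eTT -(apexE i' iT) -e.
Qed.

Definition triple_syzygies :=
  [tuple triple_syzygy (enum_val j) | j < #|triple_index|].

Lemma triple_syzygies_free : free triple_syzygies.
Proof.
apply/freeP => c; under eq_bigr do rewrite -tnth_nth tnth_mktuple.
move=> c0 j.
pose q := enum_val j.
have qD : q \in triple_index by apply: enum_valP.
have := congr1 (fun w : {ffun 'I_n -> ext k n} => w q.2 (q.1 :\ q.2)) c0.
rewrite sum_ffunE ext_sumE (bigD1 j) //= big1 ?addr0; last first.
  move=> m mj; rewrite ffunE extZE.
  apply/eqP; rewrite mulf_eq0; apply/orP; right; rewrite -[_ == 0]negbK.
  by rewrite triple_syzygy_diag ?enum_valP // (inj_eq enum_val_inj).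
rewrite ffunE extZE [RHS](_ : _ = 0); last by rewrite ffunE ext0E.
move=> /eqP.
have := triple_syzygy_diag qD qD; rewrite eqxx => nz.
by rewrite mulf_eq0 (negPf nz) orbF => /eqP.
Qed.

Lemma triple_syzygiesP w : w \in triple_syzygies ->
  exists2 p, p \in triple_index & w = triple_syzygy p.
Proof.
by move=> /mapP[j _ ->]; exists (enum_val j); rewrite // enum_valP.
Qed.

End Dependencies.

Lemma linear_syzygy_span (k : fieldType) (n : nat) (I : {vspace ext k n})
    (X : seq {ffun 'I_n -> ext k n}) :
  {in X, forall w, linear_syzygy I w} -> {in <<X>>%VS, forall w, linear_syzygy I w}.
Proof.
apply: span_ind.
  split=> [i|]; first by rewrite ffunE !mem0v.
  by rewrite big1 // => i _; rewrite ffunE mulr0.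
move=> c u v [uI u0] [vI v0]; split=> [i|].
  have /andP[ui u2] := uI i; have /andP[vi v2] := vI i.
  by rewrite !ffunE !memvD ?memvZ.
under eq_bigr do rewrite !ffunE mulrDr -scalerAr.
by rewrite big_split /= -scaler_sumr u0 v0 scaler0 addr0.
Qed.

(** * From MLS to the locality of resonance *)

Section MinimalLinearStrand.
Variables (C : fieldType) (l n : nat) (k : fieldType) (A : arrangement C l n).
Hypothesis mls : MLS k A.

(** A syzygy outside the span would extend the free family of local ones to a free family larger
    than the Betti number prescribed by [MLS]. *)
Lemma mls_syzygies w : linear_syzygy (os_ideal k A) w ->
  w \in <<triple_syzygies k A>>%VS.
Proof.
move=> hw; have [F hF] := mls; apply: contraT => nw.
have fX : free (w :: triple_syzygies k A).
  by rewrite free_cons nw triple_syzygies_free.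
have /(syzygy_dim_le_tor F (@os_ideal_low _ _ _ _ _)) :
    forall v, v \in <<w :: triple_syzygies k A>>%VS -> linear_syzygy (os_ideal k A) v.
  apply: linear_syzygy_span => v; rewrite inE => /orP[/eqP -> //|].
  by move=> /triple_syzygiesP[p pD ->]; apply: triple_syzygy_linear.
rewrite hF (eqnP fX) /= size_tuple card_ord card_triple_index.
have -> : (\sum_(X <- rank2 A) 'C(`|(mobius A X + 1)%R|, 3)
    = \sum_(X <- rank2 A) 'C(#|lines A X|, 3))%N.
  by apply: eq_big_seq => X X2; rewrite mobius_rank2 // subrK.
by rewrite ltn_mul2l /= ltnNge sum_bin_lines.
Qed.

Lemma mls_resonance_local (a : ext k n) : a \in resonance1 A -> a != 0 ->
  exists2 X, X \in rank2 A & 2 <= mobius A X /\ in_local_component A X a.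
Proof.
move=> /andP[a1 /subvPn[x]]; rewrite memv_cap -memv_preim => /andP[x1 xaI] xB a0.
rewrite lfunE /= in xaI.
have xa0 : x * a != 0.
  (* If [x a = 0] then [x = c a] is the image of the constant [c], hence a coboundary. *)
  apply: contraNneq xB => /(degree1_mul_eq0 x1 a1 a0)[c ex].
  rewrite memv_cap x1; apply: subvP (addvSl _ _) _ _; apply/memv_imgP.
  exists c%:A; first by rewrite subrr scalar_deg.
  by rewrite lfunE /= -scalerAl mul1r.
have xa2 := extdegM x1 a1.
(* The tensor of [a] with [x a], a syzygy because [a x a = - x a a = 0]. *)
pose w : {ffun 'I_n -> ext k n} := [ffun i => a [set i] *: (x * a)].
have wE i J : w i J = a [set i] * (x * a) J by rewrite ffunE extZE.
have /mls_syzygies wS : linear_syzygy (os_ideal k A) w.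
  split=> [i|]; first by rewrite ffunE !memvZ.
  transitivity (a * (x * a)); last first.
    by rewrite mulrA (degree1_anticomm x1 a1) mulNr -mulrA degree1_sqr // mulr0 oppr0.
  rewrite [X in _ = X * _]degree1_sum // mulr_suml; apply: eq_bigr => i _.
  by rewrite ffunE -scalerAr scalerAl.
have coordP (y : ext k n) : y != 0 -> exists J, y J != 0.
  move=> y0; apply/existsP; apply: contraNT y0 => /existsPn y0.
  by apply/eqP/ffunP => J; rewrite ext0E; apply/eqP/negPn/y0.
have [J xaJ] := coordP _ xa0.
have J2 : #|J| = 2%N by have [] := mem_extdeg _ _ xa2 _ xaJ.
(* If no triple contained [J], every local syzygy would vanish at [e_J], hence so would [w], forcing
   [a = 0]. *)
have [p pD sJp] : exists2 p, p \in triple_index A & J \subset p.1.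
  apply/exists_inP; apply: contraNT a0 => /exists_inPn np.
  have w0 : forall i, w i J = 0.
    move: w wS {wE}; apply: span_ind => [i|c u v u0 v0 i|_ /triple_syzygiesP[p pD ->] i].
    - by rewrite ffunE ext0E.
    - by rewrite ffunE extDE ffunE extZE u0 v0 mulr0 addr0.
    have pp : p.2 \in p.1 by move: pD; rewrite inE => /and3P[].
    apply: contraNeq (np p pD) => /(triple_syzygy_coef pp)[_ _ [m _ ->]].
    exact: subsetDl.
  rewrite (degree1_sum a1) big1 // => i _; have /eqP := w0 i.
  by rewrite wE mulf_eq0 (negPf xaJ) orbF => /eqP ->; rewrite scale0r.
have [/eqP p3 /hasP[X X2 spX]] : (#|p.1| == 3)%N /\ has (fun X => p.1 \subset lines A X) (rank2 A).
  by move: pD; rewrite !inE => /and3P[/andP[]].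
exists X => //; split.
  rewrite mobius_rank2 // lerBrDr; apply: leq_trans (subset_leq_card spX).
  by rewrite p3.
(* Both conditions are linear, so they are checked on local syzygies. One that is nonzero at [e_J]
   comes from a flat [Y] whose hyperplanes include [J]; as [J] has two elements, [Y = X]. *)
have [w0 ws] : (forall i, i \notin lines A X -> w i J = 0) /\ \sum_i w i J = 0.
  move: w wS {wE}; apply: span_ind => [|c u v [u0 us] [v0 vs]|_ /triple_syzygiesP[q qD ->]].
  - by split=> [i _|]; [|rewrite big1 // => i _]; rewrite ffunE ext0E.
  - split=> [i iX|]; first by rewrite ffunE extDE ffunE extZE u0 ?v0 // mulr0 addr0.
    under eq_bigr do rewrite ffunE extDE ffunE extZE.
    by rewrite big_split /= -mulr_sumr us vs mulr0 addr0.
  split=> [i|]; last first.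
    rewrite -ext_sumE (_ : \sum_i _ = 0) ?ext0E //.
    exact: triple_syzygy_sum.
  move: qD; rewrite !inE => /and3P[/andP[_ /hasP[Y Y2 sqY]] qq _].
  apply: contraNeq => /(triple_syzygy_coef qq)[iq _ [m _ eJ]].
  have -> : X = Y.
    apply: (rank2_lines_inj X2 Y2 (J := J)); rewrite ?J2 //.
      exact: subset_trans sJp spX.
    by apply: subset_trans sqY; rewrite eJ subsetDl.
  by have := subsetP sqY i iq; rewrite inE.
(* Cancelling the nonzero factor [(x * a) J] transfers both conditions from [w] to the coefficients
   of [a]. *)
have aE i : w i J = 0 -> a [set i] = 0.
  by move/eqP; rewrite wE mulf_eq0 (negPf xaJ) orbF => /eqP.
have a0' i : ~~ (X <= A i)%VS -> a [set i] = 0.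
  by move=> iX; apply/aE/w0; rewrite inE.
exists (fun i => a [set i]).
  rewrite big_mkcond; apply: (mulIf xaJ); rewrite mul0r mulr_suml -[RHS]ws.
  by apply: eq_bigr => i _; rewrite wE; case: ifPn => // /a0' ->.
rewrite [LHS](degree1_sum a1) [RHS]big_mkcond; apply: eq_bigr => i _.
by case: ifPn => // /a0' ->; rewrite scale0r.
Qed.

End MinimalLinearStrand.

Theorem theorem5p2 (R : realType) (k : fieldType) (hk : [pchar k] =i pred0)
    (l n : nat) (A : arrangement R[i] l n) (hA : MLS k A) (a : ext k n)
    (ha : a \in resonance1 A) (a_neq0 : a != 0) :
  exists2 X : {vspace 'rV[R[i]]_l}, X \in rank2 A
    & 2 <= mobius A X /\ in_local_component A X a.
Proof. exact: mls_resonance_local. Qed.
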